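(* Let $F$ be the free group of rank $2$. Then the diameter of $\Gamma^*(F)$ is not finite, i.e. the distances between pairs of vertices of $\Gamma^*(F)$ are unbounded.
   Context: For a group $G$, the generating graph $\Gamma(G)$ is the simple undirected graph whose vertices are the elements of $G$, two distinct vertices $g_1,g_2$ being adjacent if and only if $\langle g_1,g_2\rangle=G$. $\Gamma^*(G)$ is the subgraph of $\Gamma(G)$ induced by all vertices of $\Gamma(G)$ that are not isolated. The graph $\Gamma^*(F)$ is connected, so that all distances are finite. *)

(* Defs.v *)
From mathcomp Require Import all_boot.

Set Implicit Arguments.
Unset Strict Implicit.
Unset Printing Implicit Defensive.

Local Open Scope group_scope.

(* Subsets of a possibly infinite group are Prop-valued predicates, so that
   undecidable subgroups are not excluded. *)
Definition is_subgroup (G : groupType) (S : G -> Prop) : Prop :=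
  [/\ S 1,
      forall x y, S x -> S y -> S (x * y)
    & forall x, S x -> S x^-1].

Definition generated (G : groupType) (A : G -> Prop) (g : G) : Prop :=
  forall S : G -> Prop, is_subgroup S -> (forall x, A x -> S x) -> S g.

Definition generates2 (G : groupType) (x y : G) : Prop :=
  forall g : G, generated (fun z => z = x \/ z = y) g.

(* A multiplicative map between groups preserves 1 and inverses, so phi and psi
   range over all group homomorphisms. *)
Definition free_basis (F : groupType) (X : Type) (i : X -> F) : Prop :=
  forall (H : groupType) (f : X -> H),
    exists phi : {multiplicative F -> H},
      (forall x, phi (i x) = f x) /\
      (forall psi : {multiplicative F -> H},
         (forall x, psi (i x) = f x) -> forall g, psi g = phi g).

Definition free_of_rank (n : nat) (F : groupType) : Prop :=
  exists i : 'I_n -> F, free_basis i.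

Record simple_graph (T : Type) := SimpleGraph {
  vertex : T -> Prop;
  adj : T -> T -> Prop;
  adj_vertex : forall x y, adj x y -> vertex x;
  adj_sym : forall x y, adj x y -> adj y x;
  adj_irrefl : forall x, ~ adj x x
}.

Definition isolated (T : Type) (G : simple_graph T) (x : T) : Prop :=
  forall y, ~ adj G x y.

Section Induced.
Variables (T : Type) (G : simple_graph T) (P : T -> Prop).

Let V x := vertex G x /\ P x.
Let E x y := [/\ P x, P y & adj G x y].

Fact induced_vertex x y : E x y -> V x.
Proof. by case=> Px _ e; split=> //; apply: adj_vertex e. Qed.

Fact induced_sym x y : E x y -> E y x.
Proof. by case=> Px Py e; split=> //; apply: adj_sym e. Qed.

Fact induced_irrefl x : ~ E x x.
Proof. by case=> _ _; apply: adj_irrefl. Qed.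

Definition induced_subgraph : simple_graph T :=
  SimpleGraph induced_vertex induced_sym induced_irrefl.

End Induced.

Fixpoint walk (T : Type) (G : simple_graph T) (n : nat) (x y : T) : Prop :=
  if n is m.+1 then exists2 z, adj G x z & walk G m z y else x = y.

(* No d satisfies this when x and y lie in different components. *)
Definition is_distance (T : Type) (G : simple_graph T) (x y : T) (d : nat) :
    Prop :=
  walk G d x y /\ forall m, walk G m x y -> (d <= m)%N.

Definition finite_diameter (T : Type) (G : simple_graph T) : Prop :=
  exists D : nat, forall x y, vertex G x -> vertex G y ->
    exists2 d, is_distance G x y d & (d <= D)%N.

Section GeneratingGraph.
Variable G : groupType.

Let V (_ : G) := True.
Let E (x y : G) := x <> y /\ generates2 x y.

Fact generating_vertex x y : E x y -> V x.
Proof. by []. Qed.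

Fact generating_sym x y : E x y -> E y x.
Proof.
case=> xy gen; split=> [/esym //|g S Ssub SA].
by apply: gen => // z [] zE; apply: SA; [right|left].
Qed.

Fact generating_irrefl x : ~ E x x.
Proof. by case. Qed.

Definition generating_graph : simple_graph G :=
  SimpleGraph generating_vertex generating_sym generating_irrefl.

Definition reduced_generating_graph : simple_graph G :=
  induced_subgraph generating_graph (fun x => ~ isolated generating_graph x).

End GeneratingGraph.

(* Main.v *)
Require Import Defs.
From mathcomp Require Import all_boot.
From HB Require Import structures.
From mathcomp Require Import order ssralg ssrnum ssrint boolp.
From mathcomp Require Import zify ring.

(** Abelianization maps [F] to the lattice [int * int] and sends generating
    pairs to pairs of determinant [1] or [-1] ([generates2_det]), so a walk in
    the generating graph projects to a walk between primitive vectors in the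
    Farey graph, which has infinite diameter.

    The vertices that witness this are the words [a], [b], [ab], [b(ab)], ...,
    each the product of the two before it ([fib_word]).  Consecutive words
    generate [F], hence they form a walk and have finite distances.  Their
    images are the vectors of consecutive Fibonacci numbers.

    The lower bound is a separation argument.  In the coordinates with respect
    to two consecutive words [x], [y], a vector [(p, q)] with [p * q <= 0] lies
    behind the Farey edge from [x] to [y] or on it, and one with [0 < p * q]
    lies beyond it.  Everything behind the edge or on it is strictly behind the
    edge from [xy] to [y(xy)], two words further along; as an edge of the Farey
    graph cannot cross another one, one step of a walk gets at most onto that
    new edge ([det1_shift]).  Therefore [m] steps from [a] cannot get beyond the
    edge [m] such advances further along, while the word with index [2m + 2] is
    the product of the ends of that edge, with coordinates [(1, 1)]
    ([no_short_walk]). *)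

Set Implicit Arguments.
Unset Strict Implicit.
Unset Printing Implicit Defensive.

Import Order.TTheory GRing.Theory Num.Theory.

Local Open Scope ring_scope.

(** * Subgroups as groups, and generation by a free basis *)

Section SubgroupType.
Variables (G : groupType) (S : G -> Prop).

Definition subgroup_pred : pred G := fun x => `[< S x >].

(** Indexed by the proof of closure, because the group structure that inference
    has to find on this carrier depends on that proof. *)
Definition subgroup_type (_ : is_subgroup S) : Type := {x : G | subgroup_pred x}.

Hypothesis subS : is_subgroup S.

Fact subgroup_pred_closed : group_closed subgroup_pred.
Proof.
case: subS => S1 SM SV; split; first exact/asboolP.
by move=> x y /asboolP Sx /asboolP Sy; apply/asboolP/SM/SV.
Qed.

HB.instance Definition _ := SubChoice.on (subgroup_type subS).
HB.instance Definition _ :=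
  SubChoice_isSubGroup.Build G subgroup_pred (subgroup_type subS)
    subgroup_pred_closed.

End SubgroupType.

(** Any subgroup [S] containing the basis is a retract: the homomorphism from [F]
    to [S] that fixes the basis, followed by the inclusion, must be the
    identity by uniqueness of extensions, so every element is in [S]. *)
Lemma free_basis_generates (F : groupType) (X : Type) (i : X -> F) :
  free_basis i -> forall g, generated (fun z => exists x, z = i x) g.
Proof.
move=> freei g S subS iS.
have iS' x : subgroup_pred S (i x) by apply/asboolP/iS; exists x.
have [r [rE _]] :=
  freei (subgroup_type subS) (fun x => exist _ (i x) (iS' x)).
have [phi [_ phi_uniq]] := freei F i.
pose incl : {multiplicative subgroup_type subS -> F} := val.
have valr x : (incl \o r) (i x) = i x by rewrite /= rE.
have -> : g = val (r g).
  by rewrite [LHS](phi_uniq idfun) // -(phi_uniq (incl \o r) valr).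
exact/asboolP/(valP (r g)).
Qed.

(** * Coordinates on the abelianization *)

(** An alias on which the multiplicative group structure is the additive group
    of the integers, so that it can be the target of a homomorphism. *)
Definition mul_int : Type := int.

HB.instance Definition _ := Choice.on mul_int.
HB.instance Definition _ :=
  @isGroup.Build mul_int (0 : int) -%R +%R (@addrA int) (@add0r int) (@addr0 int)
    (@addNr int) (@addrN int).

Definition additive_char (G : groupType) (f : G -> int) : Prop :=
  {morph f : x y / (x * y)%g >-> x + y}.

Lemma additive_char1 (G : groupType) (f : G -> int) :
  additive_char f -> f 1%g = 0.
Proof. by move=> fM; have := fM 1%g 1%g; rewrite mul1g; lia. Qed.

Lemma additive_charV (G : groupType) (f : G -> int) :
  additive_char f -> {morph f : x / x^-1%g >-> - x}.
Proof.
move=> fM x; have := fM x x^-1%g; rewrite mulgV (additive_char1 fM); lia.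
Qed.

(** The coordinates on the abelianization of [G] in which the images of [x] and
    [y] are the standard basis vectors. *)
Definition dual_basis (G : groupType) (x y : G) (al be : G -> int) : Prop :=
  [/\ additive_char al, additive_char be,
      (al x, be x) = (1, 0) & (al y, be y) = (0, 1)].

Lemma free_basis_dual (F : groupType) (i : 'I_2 -> F) :
  free_basis i ->
  exists al be, dual_basis (i ord0) (i ord_max) al be.
Proof.
move=> freei.
have [phi [phiE _]] := freei (mul_int * mul_int)%type
  (fun k => if k == ord0 then (1 : int, 0 : int) else (0 : int, 1 : int)).
exists (fun g => (phi g).1), (fun g => (phi g).2).
by split=> [x y|x y||]; rewrite ?gmulfM // phiE.
Qed.

(** The standard basis vectors, as images of [x] and [y], are integer
    combinations of the images of [u] and [v]; the determinant of the latter
    therefore divides [1]. *)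
Lemma generates2_det (G : groupType) (x y u v : G) (al be : G -> int) :
  dual_basis x y al be -> generates2 u v ->
  absz (al u * be v - be u * al v)%R = 1%N.
Proof.
move=> [alM beM [alx bex] [aly bey]] genuv.
pose S g := exists m n : int,
  al g = m * al u + n * al v /\ be g = m * be u + n * be v.
have subS : is_subgroup S.
  split.
  - by exists 0, 0; rewrite !additive_char1 // !mul0r.
  - move=> g h [m [n [algE begE]]] [m' [n' [alhE behE]]].
    by exists (m + m'), (n + n'); rewrite alM beM; split; lia.
  - move=> g [m [n [algE begE]]]; exists (- m), (- n).
    by rewrite !additive_charV //; split; lia.
have genS g : S g.
  apply: genuv => // z [] ->.
    by exists 1, 0; split; ring.
  by exists 0, 1; split; ring.
have [m [n [xE1 xE2]]] := genS x; have [m' [n' [yE1 yE2]]] := genS y.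
rewrite alx in xE1; rewrite bex in xE2; rewrite aly in yE1; rewrite bey in yE2.
have detM : (m * n' - n * m') * (al u * be v - be u * al v) = 1.
  transitivity ((m * al u + n * al v) * (m' * be u + n' * be v)
      - (m * be u + n * be v) * (m' * al u + n' * al v)); first by ring.
  by rewrite -xE1 -xE2 -yE1 -yE2.
move/(congr1 absz): detM; rewrite abszM => /eqP.
by rewrite muln_eq1 => /andP[_ /eqP].
Qed.

(** * One step in the Farey graph *)

Lemma mul_gt0_cases (p q : int) :
  0 < p * q -> (0 < p) && (0 < q) || (p < 0) && (q < 0).
Proof. by case: (ltrgtP p 0) => hp; case: (ltrgtP q 0) => hq; nia. Qed.

Lemma mul_le0_cases (p q : int) :
  p * q <= 0 -> (0 <= p) && (q <= 0) || (p <= 0) && (0 <= q).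
Proof. by case: (ltrgtP p 0) => hp; case: (ltrgtP q 0) => hq; nia. Qed.

Lemma det_neq1 (a b c d : int) :
  0 <= a -> b <= 0 -> 2 <= c -> 2 <= d -> absz (a * d - b * c)%R <> 1%N.
Proof.
move=> a0 b0 c2 d2; have [-> | a1] : a = 0 \/ 1 <= a by lia.
  have [-> | b1] : b = 0 \/ b <= -1 by lia.
    by lia.
  by nia.
by nia.
Qed.

(** A neighbour [(c, d)] of a vector [(a, b)] with [a * b <= 0] still has
    coordinates of nonpositive product after the change of basis made in
    [dual_basis_next].  Otherwise [c] and [d] have the same sign, with
    [2 <= |c| < |d| < 2 * |c|].  Then [a * d] and [- (b * c)] have the same sign,
    nothing cancels in the determinant, and it is [0] or at least [2] in absolute
    value. *)
Lemma det1_shift (a b c d : int) :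
  a * b <= 0 -> absz (a * d - b * c)%R = 1%N -> (2 * c - d) * (d - c) <= 0.
Proof.
move=> /mul_le0_cases ab det.
case: (leP ((2 * c - d) * (d - c)) 0) => // /mul_gt0_cases cd; exfalso.
case/orP: ab => /andP[]; case/orP: cd => /andP[] *.
- by apply: (@det_neq1 a b c d); lia.
- by apply: (@det_neq1 a b (- c) (- d)); lia.
- by apply: (@det_neq1 (- a) (- b) c d); lia.
- by apply: (@det_neq1 (- a) (- b) (- c) (- d)); lia.
Qed.

(** * Fibonacci words *)

Fixpoint fib_word (G : groupType) (x y : G) (n : nat) : G :=
  if n is m.+1 then fib_word y (x * y)%g m else x.

(** Moving two words along changes the basis by [[1, 1], [1, 2]], and the
    coordinates by the inverse matrix. *)
Lemma dual_basis_next (G : groupType) (x y : G) (al be : G -> int) :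
  dual_basis x y al be ->
  dual_basis (x * y)%g (y * (x * y))%g
    (fun g => 2 * al g - be g) (fun g => be g - al g).
Proof.
move=> [alM beM [alx bex] [aly bey]]; split=> [g h|g h||].
- by rewrite alM beM; lia.
- by rewrite alM beM; lia.
- by rewrite !alM !beM alx bex aly bey.
- by rewrite !alM !beM alx bex aly bey.
Qed.

(** Induction on [k], advancing the basis by two words each time, which lowers the
    index of the target by two.  The start of the walk stays behind the edge or
    on it; in the end the target has coordinates [(1, 1)], which is beyond. *)
Lemma no_short_walk (G : groupType) (k m : nat) (al be : G -> int) (x y u : G) :
  dual_basis x y al be -> al u * be u <= 0 -> (m <= k)%N ->
  ~ walk (reduced_generating_graph G) m u (fib_word x y k.*2.+2).
Proof.
elim: k m al be x y u => [|k IHk] m al be x y u dualxy u_le0.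
  case: dualxy => alM beM [alx bex] [aly bey]; rewrite leqn0 => /eqP-> /= uE.
  by move: u_le0; rewrite uE alM beM alx bex aly bey.
have dual' := dual_basis_next dualxy.
case: m => [_|m le_mk [z [_ _ [_ genuz]] wz]].
  (* If u has coordinates (p, q), the product of the new ones is
     3pq - 2p^2 - q^2, and pq <= 0. *)
  by apply: (IHk 0%N) dual' _ _; first nia.
apply: IHk dual' _ le_mk wz; apply: det1_shift u_le0 _.
exact: generates2_det dualxy genuz.
Qed.

Lemma generates2_next (G : groupType) (x y : G) :
  generates2 x y -> generates2 y (x * y)%g.
Proof.
move=> gen g S subS SA; have [_ SM SV] := subS.
have Sy : S y by apply: SA; left.
have Sxy : S (x * y)%g by apply: SA; right.
apply: gen => // z [] -> //.
by rewrite -[x](mulgK y); apply: SM => //; apply: SV.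
Qed.

(** * Adjacency, walks and distances *)

(** The elements [u] and [v] are distinct because their determinant is not [0],
    and each is the reason why the other is not isolated. *)
Lemma generates2_adj (G : groupType) (x y u v : G) (al be : G -> int) :
  dual_basis x y al be -> generates2 u v ->
  adj (reduced_generating_graph G) u v.
Proof.
move=> dualxy gen; have uv : u <> v.
  by move=> uv; have := generates2_det dualxy gen; rewrite uv mulrC subrr.
have e : adj (generating_graph G) u v by [].
by split=> // iso; [apply: (iso v)|apply: (iso u); apply: adj_sym].
Qed.

Lemma fib_word_generates (G : groupType) (x y : G) (n : nat) :
  generates2 x y -> generates2 (fib_word x y n) (fib_word x y n.+1).
Proof. by elim: n x y => //= n IHn x y /generates2_next/IHn. Qed.

Lemma fib_word_walk (G : groupType) (x y u v : G) (al be : G -> int) (n : nat) :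
  dual_basis x y al be -> generates2 u v ->
  walk (reduced_generating_graph G) n u (fib_word u v n).
Proof.
move=> dualxy; elim: n u v => //= n IHn u v gen.
exists v; first exact: generates2_adj dualxy gen.
by apply: IHn; apply: generates2_next.
Qed.

Lemma walk_distance (T : Type) (G : simple_graph T) (x y : T) (n : nat) :
  walk G n x y -> exists d, is_distance G x y d.
Proof.
move=> w; have ex : exists n, `[< walk G n x y >] by exists n; apply/asboolP.
have [d /asboolP wd dmin] := ex_minnP ex.
by exists d; split=> // m wm; apply: dmin; apply/asboolP.
Qed.

Theorem corollary13 (F : groupType) (hF : free_of_rank 2 F) :
  ~ finite_diameter (reduced_generating_graph F) /\
  (forall n : nat, exists (x y : F) (d : nat),
     [/\ vertex (reduced_generating_graph F) x,
         vertex (reduced_generating_graph F) y,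
         is_distance (reduced_generating_graph F) x y d
       & (n < d)%N]).
Proof.
suff unbounded n : exists (x y : F) (d : nat),
     [/\ vertex (reduced_generating_graph F) x,
         vertex (reduced_generating_graph F) y,
         is_distance (reduced_generating_graph F) x y d
       & (n < d)%N].
  split=> // -[D diamD]; have [x [y [d [Vx Vy [_ dmin] Dd]]]] := unbounded D.
  have [d' [wd' _] d'D] := diamD x y Vx Vy.
  by have := dmin _ wd'; lia.
have [i freei] := hF; have [al [be dualab]] := free_basis_dual freei.
set a := i ord0 in dualab; set b := i ord_max in dualab.
have genab : generates2 a b.
  move=> g S subS SA; apply: (free_basis_generates freei) => // _ [k ->].
  by apply: SA; case: (unliftP ord0 k) => [j|] ->; [right|left];
    rewrite ?(ord1 j) //; congr i; apply: val_inj.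
have Vx (u v : F) : generates2 u v -> vertex (reduced_generating_graph F) u.
  by move=> gen; apply: adj_vertex (generates2_adj dualab gen).
exists a, (fib_word a b n.*2.+2).
have wn : walk (reduced_generating_graph F) n.*2.+2 a (fib_word a b n.*2.+2).
  exact: fib_word_walk dualab genab.
have [d dist_d] := walk_distance wn.
exists d; split=> //; first exact: Vx genab.
  exact: Vx (@fib_word_generates _ _ _ n.*2.+2 genab).
rewrite ltnNge; apply/negP => le_dn.
apply: (no_short_walk dualab _ le_dn dist_d.1).
by case: dualab => _ _ [-> ->] _.
Qed.
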